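(* For any field $k$, we have $N(3)\le 5$. In addition, if the characteristic of $k$ is not $2$, then $N(3)=5$.
   Context: Fix a field $k$. For $n\ge 1$, $\mathcal{N}_d^n(k)$ denotes the set of $n$-tuples $(A_1,\dots,A_n)$ of $d\times d$ matrices over $k$ such that $A_jA_{j-1}\cdots A_i$ is nilpotent for all $1\le i\le j\le n$. $N(d)$ denotes the least integer $N\ge 1$ such that $A_N\cdots A_1=0$ for every $(A_1,\dots,A_N)\in\mathcal{N}_d^N(k)$. *)

(* Defs.v *)
From mathcomp Require Import all_boot all_order all_algebra.

Set Implicit Arguments.
Unset Strict Implicit.
Unset Printing Implicit Defensive.

Import GRing.Theory.
Local Open Scope ring_scope.

Definition nilpotent_mx (k : fieldType) (d : nat) (A : 'M[k]_d) : Prop :=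
  exists m : nat, A ^+ m = 0.

(* The products run over decreasing indices, since matrices do not commute:
   seg_prod A i j is A_j A_(j-1) ... A_i and full_prod A is A_n ... A_1.
   Indices are shifted down by one: A_1, ..., A_n are tnth A 0, ...,
   tnth A (n - 1). *)
Definition seg_prod (k : fieldType) (d n : nat) (A : n.-tuple 'M[k]_d)
    (i j : 'I_n) : 'M[k]_d :=
  \prod_(l <- rev (enum 'I_n) | (i <= l <= j)%N) tnth A l.

Definition full_prod (k : fieldType) (d n : nat) (A : n.-tuple 'M[k]_d) :
    'M[k]_d :=
  \prod_(l <- rev (enum 'I_n)) tnth A l.

Definition in_calN (k : fieldType) (d n : nat) (A : n.-tuple 'M[k]_d) : Prop :=
  forall i j : 'I_n, (i <= j)%N -> nilpotent_mx (seg_prod A i j).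

Definition all_vanish (k : fieldType) (d N : nat) : Prop :=
  forall A : N.-tuple 'M[k]_d, in_calN A -> full_prod A = 0.

(* N = N(d) over k. A relation, because the existence of a least such N for a
   given d is a theorem. *)
Definition is_Nd (k : fieldType) (d N : nat) : Prop :=
  [/\ (1 <= N)%N, all_vanish k d N
    & forall M : nat, (1 <= M)%N -> all_vanish k d M -> (N <= M)%N].

(* Main.v *)
Require Import Defs.
From mathcomp Require Import all_boot all_order all_algebra.
From mathcomp Require Import ring zify.
From Stdlib Require Import Classical.

(** Why five factors suffice. In dimension three a product of three matrices
    all of whose interval products are nilpotent has rank at most one
    ([rank_mul3_nilpotent_le1]): if it had rank two, every factor would have a
    one-dimensional kernel, the three kernels would be linearly independent,
    and all three would lie in the two-dimensional image of the last factor.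

    Apply this to the middle three of five factors: the product is
    [X *m M *m Y] with [M = u *m v] an outer product. Nilpotency of [M],
    [X *m M], [M *m Y] and [X *m M *m Y] says that the functionals [v] and
    [v *m Y] both vanish on the vectors [u] and [X *m u]. If the whole product
    were non-zero, nilpotency of [X] and [Y] would make each of these pairs
    linearly independent, and the orthogonality of two planes in a
    three-dimensional space is impossible ([mul_rank_le1_nilpotent]).

    Why four do not, away from characteristic two. There are four integer
    matrices whose interval products are all nilpotent over the integers, and
    whose total product has only entries 4 and -8 ([not_all_vanish3_4]).
    Vanishing passes from a length to every larger one ([all_vanish_leq]), so
    this one example excludes all shorter lengths.

    Matrices act on row vectors on the right, so the image of [M] is its row
    space and its kernel is [kermx M]. *)

Set Implicit Arguments.
Unset Strict Implicit.
Unset Printing Implicit Defensive.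

Import GRing.Theory.
Local Open Scope ring_scope.

(** * Nilpotent matrices, images and kernels *)

Lemma nilpotent_mx_tr (k : fieldType) (d : nat) (M : 'M[k]_d) :
  nilpotent_mx M -> nilpotent_mx M^T.
Proof.
move=> [m hm]; exists m.
suff -> : M^T ^+ m = (M ^+ m)^T by rewrite hm trmx0.
elim: m {hm} => [|m IH]; first by rewrite !expr0 trmx1.
by rewrite exprS IH exprSr -!mulmxE trmx_mul.
Qed.

(** If the image of [M] met its kernel trivially, [M] would be injective on its
    image, and all its powers would have the rank of [M]. *)
Lemma nilpotent_cap_neq0 (k : fieldType) (d : nat) (M : 'M[k]_d) :
  nilpotent_mx M -> M != 0 -> (M :&: kermx M)%MS != 0.
Proof.
move=> [m hm] M0; apply/eqP=> cap0.
suff rkX n : \rank (M ^+ n.+1) = \rank M.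
  by move: (rkX m); rewrite exprS hm mulr0 mxrank0 => /esym/eqP;
     rewrite mxrank_eq0 (negPf M0).
elim: n => [|n IH]; first by rewrite expr1.
have sub : (M ^+ n.+1 <= M)%MS by rewrite exprSr -mulmxE submxMl.
rewrite -IH [M ^+ n.+2]exprSr -mulmxE -(mxrank_mul_ker (M ^+ n.+1) M).
have -> : \rank (M ^+ n.+1 :&: kermx M)%MS = 0%N.
  apply/eqP; rewrite mxrank_eq0 -submx0 -cap0 sub_capmx capmxSr andbT.
  exact: submx_trans (capmxSl _ _) sub.
by rewrite addn0.
Qed.

Lemma kermx_sub_nilpotent (k : fieldType) (d : nat) (M : 'M[k]_d) :
  nilpotent_mx M -> M != 0 -> \rank (kermx M) = 1%N -> (kermx M <= M)%MS.
Proof.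
move=> nM M0 rk1; have cap0 := nilpotent_cap_neq0 nM M0.
apply: submx_trans (capmxSl M (kermx M)).
rewrite -(mxrank_leqif_sup (capmxSr M (kermx M))) rk1.
by rewrite eqn_leq -{1}rk1 mxrankS ?capmxSr // lt0n mxrank_eq0.
Qed.

(** If the product had rank two, so would [A], [B], [C], [A *m B] and [B *m C],
    and a nilpotent matrix of rank two contains its kernel, a line, in its
    image. Left factors determine kernels and right factors determine images:
    applied to the interval products, this places ker A, ker B and ker C in the
    image of C, and ker A and ker B in the image of B. Since the ranks do not
    drop along the product, the three lines are independent, which is too much
    for the plane that is the image of C. *)
Lemma rank_mul3_nilpotent_le1 (k : fieldType) (A B C : 'M[k]_3) :
    nilpotent_mx A -> nilpotent_mx B -> nilpotent_mx C ->
    nilpotent_mx (A *m B) -> nilpotent_mx (B *m C) ->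
    nilpotent_mx (A *m B *m C) ->
  (\rank (A *m B *m C) <= 1)%N.
Proof.
move=> nA nB nC nAB nBC nABC; rewrite leqNgt; apply/negP=> rk2.
have nil_rk (M : 'M[k]_3) : nilpotent_mx M -> (1 < \rank M)%N ->
    [/\ \rank M = 2%N, \rank (kermx M) = 1%N & (kermx M <= M)%MS].
  move=> nM rM.
  have M0 : M != 0 by rewrite -mxrank_eq0; case: (\rank M) rM.
  have := nilpotent_cap_neq0 nM M0; rewrite -mxrank_eq0 => cap0.
  have capS := mxrankS (capmxSr M (kermx M)).
  have kE := mxrank_ker M.
  have [eqM eqK] : \rank M = 2%N /\ \rank (kermx M) = 1%N by lia.
  by split=> //; exact: kermx_sub_nilpotent.
have rAB : (1 < \rank (A *m B))%N by apply: leq_trans rk2 (mxrankM_maxl _ _).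
have rBC : (1 < \rank (B *m C))%N.
  by apply: leq_trans rk2 _; rewrite -mulmxA mxrankM_maxr.
have [eA kA sA] := nil_rk A nA (leq_trans rAB (mxrankM_maxl _ _)).
have [eB kB sB] := nil_rk B nB (leq_trans rAB (mxrankM_maxr _ _)).
have [eC kC sC] := nil_rk C nC (leq_trans rBC (mxrankM_maxr _ _)).
have [eAB _ sAB] := nil_rk _ nAB rAB.
have [eBC _ sBC] := nil_rk _ nBC rBC.
have [_ _ sABC] := nil_rk _ nABC rk2.
have ker_mul (M N : 'M[k]_3) : (kermx M <= kermx (M *m N))%MS.
  by apply/sub_kermxP; rewrite mulmxA mulmx_ker mul0mx.
have A_B : (kermx A <= B)%MS.
  exact: submx_trans (submx_trans (ker_mul A B) sAB) (submxMl A B).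
have A_C : (kermx A <= C)%MS.
  apply: submx_trans (submxMl (A *m B) C); apply: submx_trans sABC.
  by rewrite -mulmxA ker_mul.
have B_C : (kermx B <= C)%MS.
  exact: submx_trans (submx_trans (ker_mul B C) sBC) (submxMl B C).
(* A and A *m B have the same rank, so the image of A avoids ker B, and hence
   so does ker A; in the same way the image of B avoids ker C. *)
have cap0 (M N : 'M[k]_3) : \rank M = 2%N -> \rank (M *m N) = 2%N ->
    forall K : 'M[k]_3, (K <= M)%MS -> \rank (K :&: kermx N)%MS = 0%N.
  move=> rM rMN K KM; have := mxrank_mul_ker M N; rewrite rM rMN => /eqP.
  rewrite -[X in _ == X]addn0 eqn_add2l => /eqP capMN.
  have := mxrankS (capmxS KM (submx_refl (kermx N))).
  by rewrite capMN leqn0 => /eqP.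
have sAB_B : (kermx A + kermx B <= B)%MS by rewrite addsmx_sub A_B sB.
have := mxrank_sum_cap (kermx A) (kermx B).
rewrite (cap0 _ _ eA eAB _ sA) kA kB addn0 => rkAB.
have := mxrank_sum_cap (kermx A + kermx B)%MS (kermx C).
rewrite (cap0 _ _ eB eBC _ sAB_B) rkAB kC addn0 => rkABC.
have : (kermx A + kermx B + kermx C <= C)%MS by rewrite !addsmx_sub A_C B_C sC.
by move/mxrankS; rewrite rkABC eC.
Qed.

(** * A product of rank one between two factors *)

Lemma rank_le1_outer (k : fieldType) (m n : nat) (M : 'M[k]_(m, n)) :
  (\rank M <= 1)%N -> exists (u : 'cV_m) (v : 'rV_n), M = u *m v.
Proof.
move=> rk; suff /submxP[u ->] : (M <= nz_row M)%MS by exists u, (nz_row M).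
rewrite -(mxrank_leqif_sup (nz_row_sub M)) rank_rV nz_row_eq0 -mxrank_eq0.
by rewrite eqn_leq; lia.
Qed.

(** The only possibly non-zero eigenvalue of the outer product [u *m v] is the
    scalar [v *m u], its trace. *)
Lemma nilpotent_outer (k : fieldType) (d : nat) (u : 'cV[k]_d) (v : 'rV_d) :
  nilpotent_mx (u *m v) -> v *m u = 0.
Proof.
move=> [m hm].
have powE n : v *m (u *m v) ^+ n *m u = (v *m u) ^+ n.+1.
  elim: n => [|n IH]; first by rewrite expr0 mulmx1 expr1.
  by rewrite exprSr -mulmxE mulmxA [RHS]exprSr -IH -mulmxE !mulmxA.
move: (powE m); rewrite hm mulmx0 mul0mx [v *m u]mx11_scalar -rmorphXn /=.
move/esym/matrixP/(_ 0 0); rewrite !mxE eqxx mulr1n => /eqP.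
by rewrite expf_eq0 /= => /eqP ->; rewrite raddf0.
Qed.

(** A line stable under a nilpotent [Y] is killed by [Y]; thus [v] and [v *m Y]
    are linearly independent as soon as [v *m Y] is non-zero. *)
Lemma rank_row_nilpotent (k : fieldType) (d : nat) (v : 'rV[k]_d)
    (Y : 'M[k]_d) :
  nilpotent_mx Y -> v *m Y != 0 -> (2 <= \rank (col_mx v (v *m Y)))%N.
Proof.
move=> [m hm] vY; rewrite leqNgt; apply/negP=> rk.
have v0 : v != 0 by apply: contraNneq vY => ->; rewrite mul0mx.
have sub : (v <= col_mx v (v *m Y))%MS by rewrite -addsmxE addsmxSl.
have : (col_mx v (v *m Y) <= v)%MS.
  by rewrite -(mxrank_leqif_sup sub) eqn_leq mxrankS //= rank_rV v0.
rewrite col_mx_sub => /andP[_ /sub_rVP[a vYE]].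
have a0 : a != 0 by apply: contraNneq vY => a0; rewrite vYE a0 scale0r.
have powE n : v *m Y ^+ n = a ^+ n *: v.
  elim: n => [|n IH]; first by rewrite !expr0 mulmx1 scale1r.
  by rewrite exprSr -mulmxE mulmxA IH -scalemxAl vYE scalerA -exprSr.
move/eqP: (powE m); rewrite hm mulmx0 eq_sym scaler_eq0 (negPf v0) orbF.
by rewrite expf_eq0 (negPf a0) andbF.
Qed.

(** With [M = u *m v], the nilpotent interval products around [M] are outer
    products of [u] or [X *m u] with [v] or [v *m Y]. Their traces vanish, so
    a two-row matrix of rank two annihilates a two-column matrix of rank two,
    although the ranks of two such matrices over dimension three add up to at
    most three. *)
Lemma mul_rank_le1_nilpotent (k : fieldType) (X M Y : 'M[k]_3) :
    (\rank M <= 1)%N -> nilpotent_mx X -> nilpotent_mx Y ->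
    nilpotent_mx M -> nilpotent_mx (X *m M) -> nilpotent_mx (M *m Y) ->
    nilpotent_mx (X *m M *m Y) ->
  X *m M *m Y = 0.
Proof.
move=> /rank_le1_outer[u [v ->]] nX nY nM nXM nMY nXMY.
apply/eqP/negPn/negP=> XMY0.
have vY0 : v *m Y != 0.
  by apply: contraNneq XMY0 => vY0; rewrite -!mulmxA vY0 !mulmx0.
have Xu0 : X *m u != 0.
  by apply: contraNneq XMY0 => Xu0; rewrite mulmxA Xu0 !mul0mx.
have vu : v *m u = 0 by exact: nilpotent_outer.
have vXu : v *m (X *m u) = 0 by apply: nilpotent_outer; rewrite -mulmxA.
have vYu : v *m Y *m u = 0 by apply: nilpotent_outer; rewrite mulmxA.
have vYXu : v *m Y *m (X *m u) = 0.
  by apply: nilpotent_outer; rewrite !mulmxA in nXMY *.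
have : col_mx v (v *m Y) *m row_mx u (X *m u) = 0.
  by rewrite mul_col_row vu vXu vYu vYXu block_mx_const.
move/mulmx0_rank_max.
have row2 : (2 <= \rank (row_mx u (X *m u)))%N.
  rewrite -mxrank_tr tr_row_mx trmx_mul; apply: rank_row_nilpotent.
    exact: nilpotent_mx_tr.
  by rewrite -trmx_mul -trmx0 (inj_eq trmx_inj).
by move/(leq_trans (leq_add (rank_row_nilpotent nY vY0) row2)).
Qed.

(** * Interval products *)

Lemma seg_prodE (k : fieldType) (d n : nat) (A : n.-tuple 'M[k]_d) (i j : 'I_n) :
  seg_prod A i j = \prod_(l <- rev (index_iota i j.+1)) nth 0 A l.
Proof.
have -> : index_iota i j.+1 = [seq l <- iota 0 n | (i <= l <= j)%N].
  apply: (irr_sorted_eq ltn_trans ltnn) => [||l].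
  - exact: iota_ltn_sorted.
  - exact/(sorted_filter ltn_trans)/iota_ltn_sorted.
  - rewrite mem_index_iota mem_filter mem_iota; have := ltn_ord j; lia.
rewrite -filter_rev big_filter -val_enum_ord -map_rev big_map.
by apply: eq_bigr => l _; rewrite (tnth_nth 0).
Qed.

Lemma full_prodE (k : fieldType) (d n : nat) (A : n.-tuple 'M[k]_d) :
  full_prod A = \prod_(l <- rev (index_iota 0 n)) nth 0 A l.
Proof.
rewrite /index_iota subn0 -val_enum_ord -map_rev big_map.
by apply: eq_bigr => l _; rewrite (tnth_nth 0).
Qed.

(** The first [M] matrices of a longer admissible tuple form an admissible
    tuple, and their product is a right factor of the whole product. *)
Lemma all_vanish_leq (k : fieldType) (d M N : nat) :
  (M <= N)%N -> all_vanish k d M -> all_vanish k d N.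
Proof.
move=> MN vM A nA; pose A' := [tuple nth 0 A i | i < M].
have nthE l : (l < M)%N -> nth 0 A' l = nth 0 A l.
  by move=> lM; rewrite -[l]/(val (Ordinal lM)) -tnth_nth tnth_mktuple.
have A'0 : full_prod A' = 0.
  apply: vM => i j ij; have := nA (widen_ord MN i) (widen_ord MN j) ij.
  rewrite !seg_prodE /=; congr nilpotent_mx.
  apply: eq_big_seq => l; rewrite mem_rev mem_index_iota => lj.
  by rewrite nthE //; have := ltn_ord j; lia.
have cat_iota : index_iota 0 N = index_iota 0 M ++ index_iota M N.
  by rewrite /index_iota !subn0 -{1}(subnKC MN) iotaD.
rewrite full_prodE cat_iota rev_cat big_cat /=.
have -> : \prod_(l <- rev (index_iota 0 M)) nth 0 A l = full_prod A'.
  rewrite full_prodE; apply: eq_big_seq => l; rewrite mem_rev mem_index_iota.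
  by move=> lM; rewrite nthE.
by rewrite A'0 mulr0.
Qed.

Lemma all_vanish3_5 (k : fieldType) : all_vanish k 3 5.
Proof.
move=> A nA; rewrite full_prodE.
have nil i j : (i <= j < 5)%N ->
    nilpotent_mx (\prod_(l <- rev (index_iota i j.+1)) nth 0 A l).
  move=> /andP[ij j5]; have := nA (Ordinal (leq_ltn_trans ij j5)) (Ordinal j5) ij.
  by rewrite seg_prodE.
pose F := nth 0 A.
have rk1 : (\rank (F 3 *m F 2 *m F 1) <= 1)%N.
  apply: rank_mul3_nilpotent_le1.
  - by have := nil 3 3 isT; rewrite /= !big_cons big_nil !mulr1.
  - by have := nil 2 2 isT; rewrite /= !big_cons big_nil !mulr1.
  - by have := nil 1 1 isT; rewrite /= !big_cons big_nil !mulr1.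
  - by have := nil 2 3 isT; rewrite /= !big_cons big_nil !mulr1.
  - by have := nil 1 2 isT; rewrite /= !big_cons big_nil !mulr1.
  - by have := nil 1 3 isT; rewrite /= !big_cons big_nil !mulr1 !mulrA.
rewrite /= !big_cons big_nil mulr1 !mulrA.
have := @mul_rank_le1_nilpotent k (F 4) (F 3 *m F 2 *m F 1) (F 0).
rewrite !mulmxA; apply=> //.
- by have := nil 4 4 isT; rewrite /= !big_cons big_nil !mulr1.
- by have := nil 0 0 isT; rewrite /= !big_cons big_nil !mulr1.
- by have := nil 1 3 isT; rewrite /= !big_cons big_nil !mulr1 !mulrA.
- by have := nil 1 4 isT; rewrite /= !big_cons big_nil !mulr1 !mulrA.
- by have := nil 0 3 isT; rewrite /= !big_cons big_nil !mulr1 !mulrA.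
- by have := nil 0 4 isT; rewrite /= !big_cons big_nil !mulr1 !mulrA.
Qed.

(** * Four matrices with non-zero product *)

Definition mx3 (k : fieldType) (a b c d e f g h i : k) : 'M[k]_3 :=
  \matrix_(r, s) (nth [::] [:: [:: a; b; c]; [:: d; e; f]; [:: g; h; i]] r)`_s.

Lemma mx3M (k : fieldType) (a b c d e f g h i a' b' c' d' e' f' g' h' i' : k) :
  mx3 a b c d e f g h i *m mx3 a' b' c' d' e' f' g' h' i' =
  mx3 (a * a' + b * d' + c * g') (a * b' + b * e' + c * h')
      (a * c' + b * f' + c * i')
      (d * a' + e * d' + f * g') (d * b' + e * e' + f * h')
      (d * c' + e * f' + f * i')
      (g * a' + h * d' + i * g') (g * b' + h * e' + i * h')
      (g * c' + h * f' + i * i').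
Proof.
apply/matrixP=> r s; rewrite !mxE !big_ord_recl big_ord0 !mxE /=.
by case: r => [[|[|[|r]]] //= hr]; case: s => [[|[|[|s]]] //= hs];
   rewrite addr0 addrA.
Qed.

Lemma mx3_0 (k : fieldType) : mx3 0 0 0 0 0 0 0 0 0 = 0 :> 'M[k]_3.
Proof.
apply/matrixP=> r s; rewrite !mxE.
by case: r => [[|[|[|r]]] //= hr]; case: s => [[|[|[|s]]] //= hs].
Qed.

(** How the matrices are found: by [mul_rank_le1_nilpotent], in any example the
    two middle factors and their product have rank two. A basis and a scaling
    bring them to the form e2 -> e3 -> e1 -> 0 for [B] and e3 -> c e1,
    e1 -> e2 -> 0 for [C]. The vanishing of the first two coefficients of the
    characteristic polynomials then leaves one quadratic equation, of
    discriminant 1 - 4 c t ^ 3 up to squares, where t = Y_12 / Y_13. The choice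
    t = 1, c = -2 turns it into the square 9 and gives integer solutions. *)
Lemma not_all_vanish3_4 (k : fieldType) :
  2%N \notin [pchar k] -> ~ all_vanish k 3 4.
Proof.
move=> char2 vanish.
have two0 : (2 : k) != 0 by move: char2; rewrite inE.
pose X : 'M[k]_3 := mx3 (-3) (-1) 1 6 2 (-2) (-3) (-1) 1.
pose B : 'M[k]_3 := mx3 0 0 0 0 0 1 1 0 0.
pose C : 'M[k]_3 := mx3 0 1 0 0 0 0 (-2) 0 0.
pose Y : 'M[k]_3 := mx3 1 1 1 2 2 2 (-3) (-3) (-3).
have XB : X *m B = mx3 1 0 (-1) (-2) 0 2 1 0 (-1).
  by rewrite mx3M; congr mx3; ring.
have BC : B *m C = mx3 0 0 0 (-2) 0 0 0 1 0 by rewrite mx3M; congr mx3; ring.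
have CY : C *m Y = mx3 2 2 2 0 0 0 (-2) (-2) (-2).
  by rewrite mx3M; congr mx3; ring.
have XBC : X *m B *m C = mx3 2 1 0 (-4) (-2) 0 2 1 0.
  by rewrite XB mx3M; congr mx3; ring.
have BCY : B *m C *m Y = mx3 0 0 0 (-2) (-2) (-2) 2 2 2.
  by rewrite BC mx3M; congr mx3; ring.
have XBCY : X *m B *m C *m Y = mx3 4 4 4 (-8) (-8) (-8) 4 4 4.
  by rewrite XBC mx3M; congr mx3; ring.
have cube0 (M : 'M[k]_3) : M *m M *m M = 0 -> nilpotent_mx M.
  by move=> M0; exists 3%N; rewrite !exprS expr0 mulr1 mulrA.
have : full_prod [tuple Y; C; B; X] = 0.
  apply: vanish => i j; rewrite seg_prodE.
  case: i => [[|[|[|[|i]]]] //= hi]; case: j => [[|[|[|[|j]]]] //= hj] _;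
    rewrite /= !big_cons big_nil mulr1 ?mulrA -?mulmxE
      ?(XBCY, XBC, BCY, XB, BC, CY);
    apply: cube0; rewrite !mx3M -mx3_0; congr mx3; ring.
rewrite full_prodE /= !big_cons big_nil mulr1 !mulrA -!mulmxE XBCY.
move/matrixP/(_ 0 0); rewrite !mxE /= => /eqP.
(* The corner entry 4 is invertible away from characteristic two. *)
have -> : (4 : k) = 2 * 2 by ring.
by rewrite mulf_eq0 (negPf two0).
Qed.

Theorem proposition2p4 (k : fieldType) :
  (exists N : nat, is_Nd k 3 N /\ (N <= 5)%N) /\
  (2%N \notin [pchar k] -> is_Nd k 3 5).
Proof.
have v5 := @all_vanish3_5 k.
split=> [|char2].
  (* In characteristic two the least length may depend on the field, so it is
     found by excluded middle instead of being named. *)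
  have least n : (exists2 N, (1 <= N <= n)%N & all_vanish k 3 N) ->
      exists N, is_Nd k 3 N /\ (N <= n)%N.
    elim: n => [|n IH] [N Nn vN]; first by lia.
    have [smaller|none] := classic (exists2 N, (1 <= N <= n)%N & all_vanish k 3 N).
      by have [N' [leastN' N'n]] := IH smaller; exists N'; split; first by [];
         lia.
    exists N; split; last by lia.
    split=> // [|M M1 vM]; first by lia.
    by rewrite leqNgt; apply/negP=> MN; apply: none; exists M => //; lia.
  by apply: least; exists 5.
split=> // M M1 vM; rewrite leqNgt; apply/negP=> M4.
by apply: (not_all_vanish3_4 char2); exact: all_vanish_leq vM.
Qed.
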